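(* Let $F$ be a field. A set $V$ equipped with addition and scalar multiplication (over $F$) is a vector space (in the sense that there exists a set $J$ such that $V \cong F^J$) if and only if it is the standard notion of a vector space.
   Context: Fix an arbitrary field $F$; its elements are called scalars. A set $X$ is equipped with addition and scalar multiplication if it comes with a map $X \times X \to X$, $(x,y) \mapsto x+y$, and a map $F \times X \to X$, $(a,x) \mapsto ax$ (also written $a \cdot x$). No axioms whatsoever are imposed on these two maps. For sets $X, Y$ equipped with addition and scalar multiplication, a map $f \colon X \to Y$ is linear if $f(x+y) = f(x)+f(y)$ for all $x,y \in X$ and $f(ax) = a \cdot f(x)$ for all $a \in F$, $x \in X$. An isomorphism is a linear map that is invertible as a map (there is a map $g \colon Y \to X$ with $g \circ f$ and $f \circ g$ identity maps). Write $X \cong Y$ if there is an isomorphism from $X$ to $Y$. For a set $J$, $F^J$ (also written $\bigoplus_J F$) denotes the set of maps $s \colon J \to F$, $j \mapsto s_j$, such that the number of $j \in J$ with $s_j \neq 0$ is finite, equipped with pointwise addition $(s+t)_j = s_j + t_j$ and pointwise scalar multiplication $(as)_j = a \cdot s_j$. Vector space: a set $V$ equipped with addition and scalar multiplication is called a vector space if there exists a set $J$ such that $V \cong F^J$. Standard notion of a vector space: a set $V$ equipped with addition and scalar multiplication that contains an element $\mathbf{0}$ such that for all $a,b \in F$ and $x,y,z \in V$: (1) $x + \mathbf{0} = x$; (2) $x+(y+z) = (x+y)+z$; (3) $x+y = y+x$; (4) $1x = x$; (5) $a(bx) = (ab)x$; (6) $a(x+y) = ax+ay$; (7) $(a+b)x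 = ax+bx$; (8) $0x = \mathbf{0} = a\mathbf{0}$. *)

(* Defs.v *)
From mathcomp Require Import all_boot all_algebra.
From mathcomp Require Import boolp classical_sets functions cardinality.

Set Implicit Arguments.
Unset Strict Implicit.
Unset Printing Implicit Defensive.

Import GRing.Theory.
Local Open Scope ring_scope.
Local Open Scope classical_set_scope.

(* No axioms are imposed on the two maps; in particular the carrier may be
   empty. *)
Record addScaleType (F : fieldType) := AddScaleType {
  carrier :> Type;
  vadd : carrier -> carrier -> carrier;
  vscale : F -> carrier -> carrier
}.

Declare Scope addscale_scope.
Notation "x [+] y" := (vadd x y)
  (at level 50, left associativity) : addscale_scope.
Notation "a [*] x" := (vscale a x)
  (at level 40, left associativity) : addscale_scope.
Local Open Scope addscale_scope.

Definition is_linear (F : fieldType) (X Y : addScaleType F) (f : X -> Y) :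
    Prop :=
  (forall x y : X, f (x [+] y) = f x [+] f y) /\
  (forall (a : F) (x : X), f (a [*] x) = a [*] f x).

Definition isomorphism (F : fieldType) (X Y : addScaleType F) (f : X -> Y) :
    Prop :=
  is_linear f /\ bijective f.

Definition isomorphic (F : fieldType) (X Y : addScaleType F) : Prop :=
  exists f : X -> Y, isomorphism f.

Record finsuppFun (F : fieldType) (J : Type) := FinsuppFun {
  finsupp_val :> J -> F;
  finsuppP : finite_set [set j | finsupp_val j != 0]
}.

Lemma finsupp_add_subproof (F : fieldType) (J : Type) (s t : finsuppFun F J) :
  finite_set [set j | s j + t j != 0].
Proof.
apply: (@sub_finite_set _ _ ([set j | s j != 0] `|` [set j | t j != 0])).
  move=> j /= st; have [s0|] := eqVneq (s j) 0; last by left.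
  by right; move: st; rewrite s0 add0r.
by rewrite finite_setU; split; exact: finsuppP.
Qed.

Lemma finsupp_scale_subproof (F : fieldType) (J : Type) (a : F)
    (s : finsuppFun F J) :
  finite_set [set j | a * s j != 0].
Proof.
apply: sub_finite_set (finsuppP s) => j /=.
by apply: contra_neq => ->; rewrite mulr0.
Qed.

Definition finsupp_add (F : fieldType) (J : Type) (s t : finsuppFun F J) :
    finsuppFun F J :=
  @FinsuppFun F J (fun j => s j + t j) (finsupp_add_subproof s t).

Definition finsupp_scale (F : fieldType) (J : Type) (a : F)
    (s : finsuppFun F J) : finsuppFun F J :=
  @FinsuppFun F J (fun j => a * s j) (finsupp_scale_subproof a s).

Definition direct_sum (F : fieldType) (J : Type) : addScaleType F :=
  @AddScaleType F (finsuppFun F J) (@finsupp_add F J) (@finsupp_scale F J).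

Definition is_vector_space (F : fieldType) (V : addScaleType F) : Prop :=
  exists J : Type, isomorphic V (direct_sum F J).

Definition is_standard_vector_space (F : fieldType) (V : addScaleType F) :
    Prop :=
  exists o : V, forall (a b : F) (x y z : V),
    [/\ x [+] o = x,
        x [+] (y [+] z) = (x [+] y) [+] z,
        x [+] y = y [+] x
      & 1 [*] x = x] /\
    [/\ a [*] (b [*] x) = (a * b) [*] x,
        a [*] (x [+] y) = a [*] x [+] a [*] y,
        (a + b) [*] x = a [*] x [+] b [*] x
      & 0 [*] x = o /\ o = a [*] o].

(* Main.v *)
From mathcomp Require Import finmap.
Require Import Defs.
From mathcomp Require Import all_boot all_algebra.
From HB Require Import structures.
From mathcomp Require Import boolp classical_sets functions cardinality fsbigop.

(** A coordinate space satisfies every axiom because the axioms hold in [F]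
pointwise, and the axioms are equations, so they travel along an isomorphism;
this is [standard_iso] applied to [direct_sum_standard].

Conversely, a standard vector space is a module over the field [F]
([standard_lmodType]), and every such module has a basis [B]: Zorn's lemma
applies to the linearly independent subsets because a linear relation involves
only finitely many vectors, so that a relation on the union of a chain is
already a relation on one member of the chain ([free_bigcup]).  A maximal
independent set spans, since adjoining a vector [x] outside it creates a
relation, in which the coefficient of [x] is nonzero and can be inverted
([exists_basis]).  Sending a vector to its coordinates in [B] is then the
isomorphism onto the finitely supported functions on [B]
([lmod_vector_space]); it is linear because coordinates are unique. *)

Set Implicit Arguments.
Unset Strict Implicit.
Unset Printing Implicit Defensive.

Import GRing.Theory.
Local Open Scope ring_scope.
Local Open Scope classical_set_scope.
Local Open Scope addscale_scope.

(** * Finitely supported functions *)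

Definition supp (F : fieldType) (J : Type) (s : finsuppFun F J) : set J :=
  [set j | s j != 0].

Lemma notin_supp (F : fieldType) (J : Type) (s : finsuppFun F J) (A : set J)
    (j : J) :
  supp s `<=` A -> ~ A j -> s j = 0.
Proof. by move=> sA nAj; apply/eqP/negP => /negP/sA. Qed.

Lemma finsupp_ext (F : fieldType) (J : Type) (s t : finsuppFun F J) :
  (forall j, s j = t j) -> s = t.
Proof.
case: s t => [s Ps] [t Pt] /= /funext st; move: Ps; rewrite st => Ps.
by congr FinsuppFun; exact: Prop_irrelevance.
Qed.

Lemma supp_addW (F : fieldType) (J : Type) (s t : finsuppFun F J) (A : set J) :
  supp s `<=` A -> supp t `<=` A -> supp (finsupp_add s t) `<=` A.
Proof.
move=> sA tA j; apply: contraPP => nAj.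
by rewrite /supp /= (notin_supp sA nAj) (notin_supp tA nAj) addr0 eqxx.
Qed.

Lemma supp_scaleW (F : fieldType) (J : Type) (a : F) (s : finsuppFun F J)
    (A : set J) :
  supp s `<=` A -> supp (finsupp_scale a s) `<=` A.
Proof.
move=> sA j; apply: contraPP => nAj.
by rewrite /supp /= (notin_supp sA nAj) mulr0 eqxx.
Qed.

Lemma finsupp_single_subproof (F : fieldType) (J : eqType) (i : J) :
  finite_set [set j | (j == i)%:R != 0 :> F].
Proof.
apply: sub_finite_set (finite_set1 i) => j /=.
by case: (j =P i) => // _; rewrite eqxx.
Qed.

Definition finsupp_single (F : fieldType) (J : eqType) (i : J) :
    finsuppFun F J :=
  FinsuppFun (finsupp_single_subproof F i).

Lemma supp_single (F : fieldType) (J : eqType) (i : J) :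
  supp (finsupp_single F i) `<=` [set i].
Proof. by move=> j; rewrite /supp /=; case: (j =P i) => // _; rewrite eqxx. Qed.

Lemma finsupp_restrict_subproof (F : fieldType) (J : Type) (B : set J)
    (s : finsuppFun F J) :
  finite_set [set j : {j | B j} | s (sval j) != 0].
Proof.
apply: (@finite_preimage _ _ (supp s) sval); last exact: (finsuppP s).
by move=> [i Bi] [j Bj] _ _ /= ij; apply: eq_exist.
Qed.

Definition finsupp_restrict (F : fieldType) (J : Type) (B : set J)
    (s : finsuppFun F J) : finsuppFun F {j | B j} :=
  FinsuppFun (finsupp_restrict_subproof B s).

Definition extend0 (F : fieldType) (J : Type) (B : set J) (s : {j | B j} -> F)
    (j : J) : F :=
  if pselect (B j) is left Bj then s (exist _ j Bj) else 0.

Lemma finsupp_extend_subproof (F : fieldType) (J : Type) (B : set J)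
    (s : finsuppFun F {j | B j}) :
  finite_set [set j | extend0 s j != 0].
Proof.
apply: sub_finite_set (finite_image sval (finsuppP s)) => j /=.
rewrite /extend0; case: pselect => [Bj sj|]; last by rewrite eqxx.
by exists (exist _ j Bj).
Qed.

Definition finsupp_extend (F : fieldType) (J : Type) (B : set J)
    (s : finsuppFun F {j | B j}) : finsuppFun F J :=
  FinsuppFun (finsupp_extend_subproof s).

Lemma supp_extend (F : fieldType) (J : Type) (B : set J)
    (s : finsuppFun F {j | B j}) :
  supp (finsupp_extend s) `<=` B.
Proof.
by move=> j; rewrite /supp /= /extend0; case: pselect => //; rewrite eqxx.
Qed.

Lemma finsupp_extendK (F : fieldType) (J : Type) (B : set J) :
  cancel (@finsupp_extend F J B) (@finsupp_restrict F J B).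
Proof.
move=> s; apply: finsupp_ext => -[j Bj] /=; rewrite /extend0.
by case: pselect => // Bj'; congr (s _); apply: eq_exist.
Qed.

Lemma finsupp_restrictK (F : fieldType) (J : Type) (B : set J)
    (s : finsuppFun F J) :
  supp s `<=` B -> finsupp_extend (finsupp_restrict B s) = s.
Proof.
move=> sB; apply: finsupp_ext => j /=; rewrite /extend0.
by case: pselect => // nBj; rewrite (notin_supp sB nBj).
Qed.

(** * Linear combinations and bases in modules over a field *)

Definition lincomb (F : fieldType) (E : lmodType F) (c : finsuppFun F E) : E :=
  \sum_(v \in [set: E]) c v *: v.

(** Linear combinations with different supports can be compared once they are
written as sums over a common finite set. *)
Lemma lincombE (F : fieldType) (E : lmodType F) (c : finsuppFun F E)
    (A : set E) :
  finite_set A -> supp c `<=` A -> lincomb c = \sum_(v <- fset_set A) c v *: v.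
Proof.
move=> finA cA; apply: fsbigTE => v; rewrite in_fset_set // => nAv.
by rewrite (notin_supp cA) ?scale0r // => /mem_set; apply/negP.
Qed.

Lemma lincombD (F : fieldType) (E : lmodType F) (c d : finsuppFun F E) :
  lincomb (finsupp_add c d) = lincomb c + lincomb d.
Proof.
have finA : finite_set (supp c `|` supp d).
  by rewrite finite_setU; split; exact: finsuppP.
have cA : supp c `<=` supp c `|` supp d by left.
have dA : supp d `<=` supp c `|` supp d by right.
rewrite (lincombE finA cA) (lincombE finA dA).
rewrite (lincombE finA (supp_addW cA dA)) -big_split.
by apply: eq_bigr => v _; rewrite scalerDl.
Qed.

Lemma lincombZ (F : fieldType) (E : lmodType F) (a : F) (c : finsuppFun F E) :
  lincomb (finsupp_scale a c) = a *: lincomb c.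
Proof.
have finA : finite_set (supp c) by exact: finsuppP.
rewrite (lincombE finA (supp_scaleW (@subset_refl _ _))).
rewrite (lincombE finA (@subset_refl _ _)) scaler_sumr.
by apply: eq_bigr => v _; rewrite scalerA.
Qed.

Lemma lincomb_single (F : fieldType) (E : lmodType F) (x : E) :
  lincomb (finsupp_single F x) = x.
Proof.
rewrite (lincombE (finite_set1 x) (@supp_single _ _ x)) fset_set1.
by rewrite big_seq_fset1 /= eqxx scale1r.
Qed.

Definition free_set (F : fieldType) (E : lmodType F) (B : set E) : Prop :=
  forall c : finsuppFun F E,
    supp c `<=` B -> lincomb c = 0 -> forall v, c v = 0.

Definition spanning_set (F : fieldType) (E : lmodType F) (B : set E) : Prop :=
  forall x : E, exists2 c : finsuppFun F E, supp c `<=` B & lincomb c = x.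

(** Each element of [A] lies in some member of the chain, and the largest of
these finitely many members contains them all; for empty [A], any member will
do. *)
Lemma finite_sub_chain (T : eqType) (C : set (set T)) (A : set T) :
  C !=set0 -> total_on C subset -> finite_set A ->
  A `<=` \bigcup_(X in C) X -> exists2 X, C X & A `<=` X.
Proof.
move=> [X0 CX0] totC /finite_seqP[s ->].
elim: s => [|a s IHs] sC; first by exists X0.
have [X CX sX] : exists2 X, C X & [set` s] `<=` X.
  by apply: IHs => v vs; apply: sC; rewrite /= inE vs orbT.
have [Y CY Ya] : (\bigcup_(X in C) X) a by apply: sC; rewrite /= inE eqxx.
have [XY|YX] := totC X Y CX CY.
- by exists Y => // v /=; rewrite inE => /orP[/eqP->//|/sX/XY].
- by exists X => // v /=; rewrite inE => /orP[/eqP->|/sX//]; exact: YX.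
Qed.

Lemma free_bigcup (F : fieldType) (E : lmodType F) (C : set (set E)) :
  C `<=` @free_set F E -> total_on C subset ->
  free_set (\bigcup_(X in C) X).
Proof.
move=> freeC totC c cC c0 v; apply: contrapT => /eqP cv.
have C0 : C !=set0 by have [X CX _] := cC v cv; exists X.
have [X CX cX] := finite_sub_chain C0 totC (finsuppP c) cC.
by move/eqP: cv; apply; exact: (freeC X CX c cX c0 v).
Qed.

(** For [x] outside the maximal free set [B], a nontrivial relation [c] on
[x |` B] has [c x != 0], for otherwise it would be a relation on [B].  Removing
the [x] term from [c] leaves a combination of elements of [B] with value
[- c x *: x], which is then divided by [- c x]. *)
Lemma exists_basis (F : fieldType) (E : lmodType F) :
  exists B : set E, free_set B /\ spanning_set B.
Proof.
have [B [freeB maxB]] := Zorn_bigcup (@free_bigcup F E).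
exists B; split => // x; have [Bx|nBx] := pselect (B x).
  exists (finsupp_single F x); last exact: lincomb_single.
  by move=> v /supp_single ->.
have /existsNP[c /not_implyP[cB /not_implyP[c0 /existsNP[w cw]]]] :
    ~ free_set (x |` B).
  apply: maxB; split; first exact: subsetUr.
  by move=> /(_ x) H; apply: nBx; apply: H; left.
have cx : c x != 0.
  apply: contra_notN cw => /eqP cx; apply: freeB c0 w => v cv.
  by have [vx|//] := cB v cv; move: cv; rewrite vx /supp /= cx eqxx.
(* [d] is [c] with the coefficient of [x] replaced by 0. *)
pose d := finsupp_add c (finsupp_scale (- c x) (finsupp_single F x)).
have dB : supp d `<=` B.
  move=> v dv; have : (x |` B) v.
    apply: (supp_addW cB _ dv).
    by apply: supp_scaleW => u /supp_single ->; left.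
  by case=> // vx; move: dv; rewrite vx /supp /= eqxx mulr1 subrr eqxx.
exists (finsupp_scale (- (c x)^-1) d); first exact: supp_scaleW.
rewrite lincombZ lincombD c0 add0r lincombZ lincomb_single.
by rewrite scalerA mulrNN mulVf // scale1r.
Qed.

Lemma free_lincomb_inj (F : fieldType) (E : lmodType F) (B : set E)
    (c d : finsuppFun F E) :
  free_set B -> supp c `<=` B -> supp d `<=` B -> lincomb c = lincomb d ->
  c = d.
Proof.
move=> freeB cB dB cd; apply: finsupp_ext => v; apply/eqP.
rewrite -subr_eq0 -mulN1r; apply/eqP.
apply: (freeB (finsupp_add c (finsupp_scale (- 1) d))).
- exact: supp_addW (supp_scaleW dB).
- by rewrite lincombD lincombZ cd scaleN1r subrr.
Qed.

Lemma lmod_vector_space (F : fieldType) (E : lmodType F) :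
  is_vector_space (AddScaleType (@GRing.add E) (@GRing.scale F E)).
Proof.
have [B [freeB spanB]] := exists_basis E.
have /choice[coord coordP] :
    forall x, exists c : finsuppFun F E, supp c `<=` B /\ lincomb c = x.
  by move=> x; have [c cB cx] := spanB x; exists c.
have coordB x : supp (coord x) `<=` B by have [] := coordP x.
have coordK x : lincomb (coord x) = x by have [] := coordP x.
have coord_unique c x : supp c `<=` B -> lincomb c = x -> coord x = c.
  by move=> cB cx; apply: free_lincomb_inj freeB _ cB _; rewrite ?coordK.
exists {v | B v}, (fun x => finsupp_restrict B (coord x)); split; first split.
- move=> x y /=; rewrite (coord_unique (finsupp_add (coord x) (coord y))).
  + by apply: finsupp_ext.
  + exact: supp_addW.
  + by rewrite lincombD !coordK.
- move=> a x /=; rewrite (coord_unique (finsupp_scale a (coord x))).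
  + by apply: finsupp_ext.
  + exact: supp_scaleW.
  + by rewrite lincombZ coordK.
- exists (fun s => lincomb (finsupp_extend s)) => [x|s] /=.
  + by rewrite finsupp_restrictK.
  + by rewrite (coord_unique (finsupp_extend s)) ?finsupp_extendK //;
      exact: supp_extend.
Qed.

(** * Comparison of the two notions *)

(** The scalar [-1] provides the opposites: [(-1) x + x = (-1 + 1) x = 0 x]. *)
Lemma standard_lmodType (F : fieldType) (V : addScaleType F) :
  is_standard_vector_space V ->
  exists E : lmodType F, V = AddScaleType (@GRing.add E) (@GRing.scale F E).
Proof.
case: V => V add scale [/= o ax].
have addC : commutative add by move=> x y; have [[]] := ax 0 0 x y o.
have addA : associative add by move=> x y z; have [[]] := ax 0 0 x y z.
have add0 : left_id o add by move=> x; rewrite addC; have [[]] := ax 0 0 x o o.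
have addN : left_inverse o (scale (- 1)) add.
  move=> x; have [[_ _ _ x1] _] := ax 0 0 x o o.
  have [_ [_ _ + _]] := ax (- 1) 1 x o o; rewrite addNr x1 => <-.
  by have [_ [_ _ _ []]] := ax 0 0 x o o.
have scaleA a b x : scale a (scale b x) = scale (a * b) x.
  by have [_ []] := ax a b x o o.
have scale1 : left_id 1 scale by move=> x; have [[]] := ax 0 0 x o o.
have scaleDr : right_distributive scale add.
  by move=> a x y; have [_ []] := ax a 0 x y o.
have scaleDl x : {morph scale^~ x : a b / a + b >-> add a b}.
  by move=> a b; have [_ []] := ax a b x o o.
pose T : choiceType := HB.pack V (gen_eqMixin V) (gen_choiceMixin V).
pose Z : zmodType :=
  HB.pack V T (GRing.isZmodule.Build T addA addC add0 addN).
pose E : lmodType F := HB.pack V Z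
  (GRing.Zmodule_isLmodule.Build F Z scaleA scale1 scaleDr scaleDl).
by exists E.
Qed.

Lemma direct_sum_standard (F : fieldType) (J : Type) :
  is_standard_vector_space (direct_sum F J).
Proof.
have fin0 : finite_set [set j : J | (0 : F) != 0].
  by apply: sub_finite_set (finite_set0 J) => j /=; rewrite eqxx.
exists (FinsuppFun fin0) => a b x y z; do 2!split; last split;
  apply: finsupp_ext => j /=.
- exact: addr0.
- exact: addrA.
- exact: addrC.
- exact: mul1r.
- exact: mulrA.
- exact: mulrDr.
- exact: mulrDl.
- exact: mul0r.
- by rewrite mulr0.
Qed.

Lemma standard_iso (F : fieldType) (X Y : addScaleType F) :
  isomorphic X Y -> is_standard_vector_space Y -> is_standard_vector_space X.
Proof.
move=> [f [[fD fZ] [g fK gK]]] [o ax]; exists (g o) => a b x y z.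
have [[add0 addA addC scale1] [scaleA scaleDr scaleDl [scale0 scaleo]]] :=
  ax a b (f x) (f y) (f z).
do 2!split; last split; apply: (can_inj fK); rewrite ?(fD, fZ, gK) //.
Qed.

Theorem proposition2 (F : fieldType) (V : addScaleType F) :
  is_vector_space V <-> is_standard_vector_space V.
Proof.
split=> [[J isoV]|/standard_lmodType[E ->]].
- exact: standard_iso isoV (direct_sum_standard F J).
- exact: lmod_vector_space.
Qed.
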